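(* Let $\hat{\boldsymbol{U}}=(\hat{\boldsymbol{u}}_0,\ldots,\hat{\boldsymbol{u}}_{n-1})$ be the quasimatrix of the first $n$ dual snapshots, whose columns span the space $\hat{\mathfrak X}$. The following statements hold: (i) There exists an orthonormal basis of the space $\hat{\mathfrak X}$, given by the columns of a quasimatrix $\hat{\boldsymbol{V}}=(\hat{\boldsymbol{v}}_0,\ldots,\hat{\boldsymbol{v}}_{n-1})$, satisfying $$\hat{\boldsymbol{U}}=\hat{\boldsymbol{V}}\,\hat{\boldsymbol{R}},$$ where $\hat{\boldsymbol{R}}=(\hat{\boldsymbol{u}}^{ROM}_0,\ldots,\hat{\boldsymbol{u}}^{ROM}_{n-1})\in\mathbb R^{nm\times nm}$ is the matrix of the first $n$ ROM dual snapshots, and $\hat{\boldsymbol{R}}$ is block upper triangular. (ii) The matrix $\boldsymbol{\mathcal L}^{ROM}$ is the Galerkin-Petrov projection of the operator $\mathcal L$ on the spaces $\mathfrak X$ and $\hat{\mathfrak X}$: $$\boldsymbol{\mathcal L}^{ROM}=\boldsymbol{V}^T\mathcal L\,\hat{\boldsymbol{V}},$$ with $\hat{\boldsymbol{V}}$ as in (i).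
   Context: Setting. $H$ is the real Hilbert space $L^2(\Omega)$ of (possibly vector valued) wave fields on a domain $\Omega\subset\mathbb R^d$. $L(q)$ is a first order partial differential operator (with homogeneous boundary conditions built into its domain) with adjoint $L(q)^T$. The results do not depend on the specific form of $L(q)$; what matters is that $L(q)L(q)^T$ is a self-adjoint nonnegative-definite operator on $H$. Let $\tau>0$ and let $m\ge1$, $n\ge2$ be integers. Wave propagator: $\mathcal P=\cos\big(\tau\sqrt{L(q)L(q)^T}\big)$, defined by functional calculus (bounded, self-adjoint, spectrum in $[-1,1]$). $\mathcal L$ denotes a (square root) factor of the nonnegative operator $\frac{2}{\tau^2}(I-\mathcal P)$: a bounded operator $\mathcal L:\hat H\to H$ from a real Hilbert space $\hat H$ (of dual wave fields) with adjoint $\mathcal L^T:H\to\hat H$ such that $$\frac{2}{\tau^2}(I-\mathcal P)=\mathcal L\mathcal L^T.$$ Block conventions. An $m$-tuple $\boldsymbol{w}=(w^{(1)},\ldots,w^{(m)})$ of elements of $H$ (or $\hat H$) is regarded as a row; operators act on it entrywise, matrices multiply it on the right. $\langle\boldsymbol{v},\boldsymbol{w}\rangle$ is the $m\times m$ matrix with entries $\langle v^{(r)},w^{(s)}\rangle$. A quasimatrix $\boldsymbol{W}=(\boldsymbol{w}_0,\ldots,\boldsymbol{w}_{n-1})$ is a row of $n$ such $m$-tuples (block columns), hence $nm$ columns; for two quasimatrices in the same space, $\boldsymbol{W}^T\boldsymbol{Z}$ is the $nm\times nm$ matrix with $m\times m$ blocks $\langle\boldsymbol{w}_i,\boldsymbol{z}_j\rangle$,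 $i,j=0,\ldots,n-1$. $\boldsymbol{e}_j\in\mathbb R^{nm\times m}$ has the identity $\boldsymbol{I}_m$ in block position $j$ (counted from $0$) and zeros elsewhere. Snapshots. $\boldsymbol{b}$ is a given $m$-tuple in $H$, $\boldsymbol{u}_j=\cos\big(j\tau\sqrt{L(q)L(q)^T}\big)\boldsymbol{b}$, $\boldsymbol{U}=(\boldsymbol{u}_0,\ldots,\boldsymbol{u}_{n-1})$, and $\mathfrak X\subset H$ is the span of all columns of $\boldsymbol{U}$. Standing assumption: the snapshots are linearly independent up to time $n\tau$, i.e. all the components of $\boldsymbol{u}_0,\ldots,\boldsymbol{u}_n$ are linearly independent in $H$. Dual snapshots. The $m$-tuples $\hat{\boldsymbol{u}}_j$ in $\hat H$ are defined by the first order (leap-frog) form of the time stepping: for $j\ge0$, $$\frac{\boldsymbol{u}_{j+1}-\boldsymbol{u}_j}{\tau}=-\mathcal L\hat{\boldsymbol{u}}_j,\qquad \frac{\hat{\boldsymbol{u}}_j-\hat{\boldsymbol{u}}_{j-1}}{\tau}=\mathcal L^T\boldsymbol{u}_j,\qquad \boldsymbol{u}_0=\boldsymbol{b},\qquad \hat{\boldsymbol{u}}_0+\hat{\boldsymbol{u}}_{-1}=0,$$ so that $\hat{\boldsymbol{u}}_0=\frac{\tau}{2}\mathcal L^T\boldsymbol{b}$ and $\hat{\boldsymbol{u}}_j=\hat{\boldsymbol{u}}_{j-1}+\tau\mathcal L^T\boldsymbol{u}_j$ for $j\ge1$. $\hat{\mathfrak X}\subset\hat H$ is the span of all the components of $\hat{\boldsymbol{u}}_0,\ldots,\hat{\boldsymbol{u}}_{n-1}$.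 ROM. $\boldsymbol{M}=\boldsymbol{U}^T\boldsymbol{U}$, $\boldsymbol{S}=\boldsymbol{U}^T\mathcal P\boldsymbol{U}$; $\boldsymbol{M}=\boldsymbol{R}^T\boldsymbol{R}$ is a block Cholesky factorization with $\boldsymbol{R}$ block upper triangular (invertible); $\boldsymbol{V}=\boldsymbol{U}\boldsymbol{R}^{-1}$ (its columns are an orthonormal basis of $\mathfrak X$); $\boldsymbol{\mathcal P}^{ROM}=\boldsymbol{R}^{-T}\boldsymbol{S}\boldsymbol{R}^{-1}=\boldsymbol{V}^T\mathcal P\boldsymbol{V}$; $\boldsymbol{b}^{ROM}=\boldsymbol{R}\boldsymbol{e}_0$. The ROM snapshots $\boldsymbol{u}^{ROM}_j\in\mathbb R^{nm\times m}$ satisfy $\boldsymbol{u}^{ROM}_{j+1}=2\boldsymbol{\mathcal P}^{ROM}\boldsymbol{u}^{ROM}_j-\boldsymbol{u}^{ROM}_{j-1}$ for $j\ge0$, with $\boldsymbol{u}^{ROM}_0=\boldsymbol{b}^{ROM}$ and $\boldsymbol{u}^{ROM}_1=\boldsymbol{u}^{ROM}_{-1}=\boldsymbol{R}\boldsymbol{e}_1$. The matrix $\boldsymbol{\mathcal L}^{ROM}\in\mathbb R^{nm\times nm}$ is the block lower triangular factor in the block Cholesky factorization $\frac{2}{\tau^2}(\boldsymbol{I}_{nm}-\boldsymbol{\mathcal P}^{ROM})=\boldsymbol{\mathcal L}^{ROM}(\boldsymbol{\mathcal L}^{ROM})^T$. ROM dual snapshots. $\hat{\boldsymbol{u}}^{ROM}_j\in\mathbb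 R^{nm\times m}$ are defined by the first order form of the ROM time stepping: for $j\ge0$, $$\frac{\boldsymbol{u}^{ROM}_{j+1}-\boldsymbol{u}^{ROM}_j}{\tau}=-\boldsymbol{\mathcal L}^{ROM}\hat{\boldsymbol{u}}^{ROM}_j,\qquad \frac{\hat{\boldsymbol{u}}^{ROM}_j-\hat{\boldsymbol{u}}^{ROM}_{j-1}}{\tau}=(\boldsymbol{\mathcal L}^{ROM})^T\boldsymbol{u}^{ROM}_j,\qquad \boldsymbol{u}^{ROM}_0=\boldsymbol{b}^{ROM},\qquad \hat{\boldsymbol{u}}^{ROM}_0+\hat{\boldsymbol{u}}^{ROM}_{-1}=0,$$ so that $\hat{\boldsymbol{u}}^{ROM}_0=\frac{\tau}{2}(\boldsymbol{\mathcal L}^{ROM})^T\boldsymbol{b}^{ROM}$ and $\hat{\boldsymbol{u}}^{ROM}_j=\hat{\boldsymbol{u}}^{ROM}_{j-1}+\tau(\boldsymbol{\mathcal L}^{ROM})^T\boldsymbol{u}^{ROM}_j$ for $j\ge1$. *)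

(* Defs.v *)
From HB Require Import structures.
From mathcomp Require Import all_boot all_order all_algebra.
From mathcomp Require Import all_classical all_reals all_analysis.

Set Implicit Arguments.
Unset Strict Implicit.
Unset Printing Implicit Defensive.

Import Order.TTheory GRing.Theory Num.Theory.
Import numFieldNormedType.Exports.

Local Open Scope classical_set_scope.
Local Open Scope ring_scope.

(* Real Hilbert spaces: complete normed modules over R whose norm comes from
   an inner product. *)
HB.mixin Record CompleteNormedModule_isHilbert (R : realType) H
    of CompleteNormedModule R H := {
  inner : H -> H -> R ;
  innerC : forall x y, inner x y = inner y x ;
  innerDl : forall x y z, inner (x + y) z = inner x z + inner y z ;
  innerZl : forall (a : R) x y, inner (a *: x) y = a * inner x y ;
  inner_norm : forall x, inner x x = `|x| ^+ 2
}.

#[short(type="hilbertType")]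
HB.structure Definition Hilbert (R : realType) :=
  { H of CompleteNormedModule R H & CompleteNormedModule_isHilbert R H }.

Notation "''[' x , y ]" := (inner x y) : ring_scope.

(* Possibly unbounded operators K -> H, represented by their graphs. *)
Section UnboundedOperators.
Context {R : realType}.
Implicit Types K H G : hilbertType R.

Definition op_dom K H (T : set (K * H)) : set K := [set x | exists y, T (x, y)].

Definition densely_defined_operator K H (T : set (K * H)) : Prop :=
  [/\ T (0, 0),
      forall (a : R) p q, T p -> T q -> T (a *: p.1 + q.1, a *: p.2 + q.2),
      forall x y y', T (x, y) -> T (x, y') -> y = y' &
      dense (op_dom T)].

Definition op_adjoint K H (T : set (K * H)) : set (H * K) :=
  [set p | forall q, T q -> '[q.2, p.1] = '[q.1, p.2]].

Definition op_comp K H G (T : set (H * G)) (S : set (K * H)) : set (K * G) :=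
  [set p | exists2 y, S (p.1, y) & T (y, p.2)].

Definition op_graph K H (T : K -> H) : set (K * H) := [set p | p.2 = T p.1].

Definition selfadjoint_nonneg H (A : set (H * H)) : Prop :=
  [/\ densely_defined_operator A, op_adjoint A = A &
      forall p, A p -> 0 <= '[p.2, p.1]].

End UnboundedOperators.

Section FunctionalCalculus.
Context {R : realType} {H : hilbertType R}.
Implicit Types E : set R -> {linear H -> H}.

(* Projection-valued measures on the Borel sets of R. *)
Definition spectral_measure E : Prop :=
  [/\ forall B, measurable B -> forall x y, '[E B x, y] = '[x, E B y],
      forall x, E setT x = x,
      forall B C, measurable B -> measurable C ->
        forall x, E (B `&` C) x = E B (E C x) &
      forall F : nat -> set R, (forall k, measurable (F k)) ->
        trivIset setT F ->
        forall x, series (fun k => E (F k) x) @ \oo --> E (\bigcup_k F k) x].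

Definition scalar_spectral_measure E (x : H) : set R -> \bar R :=
  fun B => ('[E B x, x])%:E.

(* T is the operator \int f(l) dE(l), for a real Borel function f: T has domain
   {x | \int |f|^2 dmu_x < +oo}, where mu_x(B) = <E(B)x, x>, is symmetric, and
   <T x, x> = \int f dmu_x on its domain; by polarization this determines T.
   The spectral measure of a self-adjoint A is the E for which A is the spectral
   integral of the identity, and f(A) is then the spectral integral of f. *)
Definition spectral_integral E (f : R -> R) (T : set (H * H)) : Prop :=
  [/\ forall x, op_dom T x <->
        (\int[scalar_spectral_measure E x]_l ((f l) ^+ 2)%:E < +oo)%E,
      forall p q, T p -> T q -> '[p.2, q.1] = '[p.1, q.2] &
      forall p, T p ->
        ('[p.2, p.1])%:E
        = (\int[scalar_spectral_measure E p.1]_l (f l)%:E)%E].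

End FunctionalCalculus.

(* A p-tuple of elements of H is a row 'rV[H]_p, on which operators act by
   map_mx and matrices multiply on the right. *)
Section Quasimatrices.
Context {R : realType} {H : hilbertType R}.

Definition qmul p q (W : 'rV[H]_p) (A : 'M[R]_(p, q)) : 'rV[H]_q :=
  \row_j \sum_i A i j *: W 0 i.

Definition gram p q (W : 'rV[H]_p) (Z : 'rV[H]_q) : 'M[R]_(p, q) :=
  \matrix_(i, j) '[W 0 i, Z 0 j].

Definition colspan p (W : 'rV[H]_p) : set H :=
  [set x | exists c : 'I_p -> R, x = \sum_i c i *: W 0 i].

Definition lin_indep p (W : 'rV[H]_p) : Prop :=
  forall c : 'I_p -> R, \sum_i c i *: W 0 i = 0 -> forall i, c i = 0.

Definition orthonormal_basis p (W : 'rV[H]_p) (X : set H) : Prop :=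
  gram W W = 1%:M /\ colspan W = X.

Definition quasimatrix n m (w : nat -> 'rV[H]_m) : 'rV[H]_(\sum_(i < n) m) :=
  \mxrow_(j < n) w j.

End Quasimatrices.

Section BlockMatrices.
Context {R : realType}.

Definition block_upper_triangular n m (A : 'M[R]_(\sum_(i < n) m)) : Prop :=
  forall i j : 'I_n, (j < i)%N -> submxblock A i j = 0.

Definition block_lower_triangular n m (A : 'M[R]_(\sum_(i < n) m)) : Prop :=
  forall i j : 'I_n, (i < j)%N -> submxblock A i j = 0.

Definition block_unit n m (j : nat) : 'M[R]_(\sum_(i < n) m, m) :=
  \mxcol_(i < n) (i == j :> nat)%:R%:M.

End BlockMatrices.

(* C t stands for cos(t sqrt(L L^T)). *)
Definition snapshot (R : realType) (H : hilbertType R) (C : R -> {linear H -> H})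
    (tau : R) m (b : 'rV[H]_m) (j : nat) : 'rV[H]_m :=
  map_mx (C (j%:R * tau)) b.

(* The term of index -1 of the leap-frog scheme is eliminated by
   uhat_0 + uhat_{-1} = 0.  The companion equation
   (u_{j+1} - u_j) / tau = - L uhat_j is not assumed: it follows from
   L L^T = 2 / tau^2 (I - P) and the three-term recursion satisfied by u. *)
Fixpoint dual_snapshot (R : realType) (H Hh : hilbertType R) (tau : R)
    (LT : H -> Hh) m (u : nat -> 'rV[H]_m) (j : nat) : 'rV[Hh]_m :=
  match j with
  | 0 => map_mx (fun x => (tau / 2) *: LT x) (u 0%N)
  | k.+1 => dual_snapshot tau LT u k + map_mx (fun x => tau *: LT x) (u k.+1)
  end.

(* u_{-1} only enters the recursion at j = 0, where u_{-1} = u_1 turns it into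
   u_1 = P u_0; with u0 = R e_0 and u1 = R e_1 this holds by construction of P. *)
Fixpoint rom_snapshot (R : realType) N m (P : 'M[R]_N) (u0 u1 : 'M[R]_(N, m))
    (j : nat) : 'M[R]_(N, m) :=
  match j with
  | 0 => u0
  | k.+1 => match k with
            | 0 => u1
            | l.+1 => 2 *: (P *m rom_snapshot P u0 u1 k) - rom_snapshot P u0 u1 l
            end
  end.

Fixpoint rom_dual_snapshot (R : realType) N m (tau : R) (L : 'M[R]_N)
    (u : nat -> 'M[R]_(N, m)) (j : nat) : 'M[R]_(N, m) :=
  match j with
  | 0 => (tau / 2) *: (L^T *m u 0%N)
  | k.+1 => rom_dual_snapshot tau L u k + tau *: (L^T *m u k.+1)
  end.

(* Main.v *)
Require Import Defs.
From HB Require Import structures.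
From mathcomp Require Import all_boot all_order all_algebra.
From mathcomp Require Import all_classical all_reals all_analysis.
From mathcomp Require Import ring lra.
Import Order.TTheory GRing.Theory Num.Theory.
Import numFieldNormedType.Exports.
Local Open Scope classical_set_scope.
Local Open Scope ring_scope.

Set Implicit Arguments.
Unset Strict Implicit.
Unset Printing Implicit Defensive.

(** Both the dual snapshots and their reduced counterparts are images of the
    same linear combinations of snapshots.  Summing the leap-frog recursion,
    uh_j = LT (U h_j), where the coefficients
    h_j = tau (e_0 / 2 + e_1 + ... + e_j) do not depend on the operators.  On the
    reduced side the snapshot number j is Rb e_j as long as j < n
    ([rom_snapshotE]), so that the dual one is LROM^T Rb h_j.  With
    Hm = (h_0, ..., h_{n-1}) this reads Uh = LT (U Hm) and Rh = LROM^T Rb Hm;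
    the latter is a product of three block upper triangular matrices.

    The Galerkin projection gives U^T (L LT) U = Rb^T (LROM LROM^T) Rb, whence
    Uh^T Uh = Rh^T Rh.  The dual snapshots are linearly independent, because
    L uh_j = (u_j - u_{j+1}) / tau and u_0, ..., u_n are independent
    ([dual_snapshots_lin_indep]).  So Rh is invertible and Vh = Uh Rh^-1 is
    orthonormal.  It is also the only quasimatrix with Uh = Vh Rh, and
    V^T L Vh = Rb^-T (U^T L LT U) Hm Rh^-1 = LROM (LROM^T Rb Hm) Rh^-1 = LROM.

    All this rests on the three-term recursion 2 P u_j = u_{j+1} + u_{j-1}, that
    is, on cos (p a) + cos (q a) = 2 cos (s a) cos (t a) being inherited by the
    operators C ([cos_family_product]).  These are only known through their
    quadratic forms with respect to the spectral measure E, and no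
    multiplicativity of the functional calculus is given.  It is recovered by
    slicing: an operator whose form is the integral of f commutes with E, and is
    within e of the scalar c on the range of E B when f is within e of c on B.
    On a set B where the four cosines oscillate by at most d, the operators are
    d-close to four scalars which satisfy the identity exactly, so the defect
    D = C p + C q - 2 C s C t has norm at most 6 d there.  Finitely many such
    sets partition the line, D preserves the orthogonal decomposition that they
    induce, hence D has norm at most 6 d, for every d > 0. *)

(** * Inner products *)

Section Inner.
Context {R : realType} {H : hilbertType R}.
Implicit Types x y z : H.

Lemma innerZr (a : R) x y : '[x, a *: y] = a * '[x, y].
Proof. by rewrite innerC innerZl innerC. Qed.

Lemma innerDr x y z : '[x, y + z] = '[x, y] + '[x, z].
Proof. by rewrite innerC innerDl !(innerC x). Qed.

Lemma inner0l x : '[(0 : H), x] = 0.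
Proof. by rewrite -(scale0r (0 : H)) innerZl mul0r. Qed.

Lemma inner0r x : '[x, (0 : H)] = 0.
Proof. by rewrite innerC inner0l. Qed.

Lemma innerNl x y : '[- x, y] = - '[x, y].
Proof. by rewrite -scaleN1r innerZl mulN1r. Qed.

Lemma innerNr x y : '[x, - y] = - '[x, y].
Proof. by rewrite innerC innerNl innerC. Qed.

Lemma inner_suml (I : finType) (f : I -> H) y :
  '[\sum_i f i, y] = \sum_i '[f i, y].
Proof.
by elim/big_rec2: _ => [|i a b _ <-]; rewrite ?inner0l ?innerDl.
Qed.

Lemma inner_sumr (I : finType) (f : I -> H) y :
  '[y, \sum_i f i] = \sum_i '[y, f i].
Proof. by rewrite innerC inner_suml; under eq_bigr do rewrite innerC. Qed.

Lemma inner_ge0 x : 0 <= '[x, x].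
Proof. by rewrite inner_norm exprn_ge0. Qed.

Lemma inner_eq0 x : '[x, x] = 0 -> x = 0.
Proof. by rewrite inner_norm => /eqP; rewrite sqrf_eq0 normr_eq0 => /eqP. Qed.

Lemma inner_polarization x y : '[x, y] = (`|x + y| ^+ 2 - `|x - y| ^+ 2) / 4.
Proof.
rewrite -!inner_norm !(innerDl, innerDr, innerNl, innerNr) (innerC y x).
by field.
Qed.

Lemma cvg_innerl (f : nat -> H) x y :
  f @ \oo --> x -> (fun n => '[f n, y]) @ \oo --> '[x, y].
Proof.
move=> fx; rewrite inner_polarization.
under eq_fun do rewrite inner_polarization.
apply: cvgMr_tmp; rewrite !expr2.
have fD : (fun n => `|f n + y|) @ \oo --> `|x + y|.
  by apply: cvg_norm; apply: cvgD => //; exact: cvg_cst.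
have fB : (fun n => `|f n - y|) @ \oo --> `|x - y|.
  by apply: cvg_norm; apply: cvgB => //; exact: cvg_cst.
by apply: cvgB; under eq_fun do rewrite expr2; exact: cvgM.
Qed.

End Inner.

(** * Spectral measures and functional calculus *)

Section Spectral.
Import HBNNSimple.
Context {R : realType} {H : hilbertType R} (E : set R -> {linear H -> H}).
Hypothesis hE : spectral_measure E.
Implicit Types (x y : H) (B A : set R).

Let symE B : measurable B -> forall x y, '[E B x, y] = '[x, E B y].
Proof. by case: hE => + _ _ _; exact. Qed.

Let ET x : E setT x = x.
Proof. by case: hE. Qed.

Let EI A B : measurable A -> measurable B ->
  forall x, E (A `&` B) x = E A (E B x).
Proof. by case: hE => _ _ + _; exact. Qed.

(** The countable additivity of E over a sequence of empty sets makes the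
    constant series of terms E set0 x converge, so its terms vanish. *)
Lemma pvm_set0 x : E set0 x = 0.
Proof.
have [_ _ _ /(_ (fun=> set0) (fun=> measurable0))] := hE.
rewrite bigcup0// => /(_ (@trivIset_set0 _ _ _) x) h.
have /cvg_series_cvg_0 /cvg_lim : cvgn (series (fun=> E set0 x)).
  by apply/cvg_ex; exists (E set0 x).
by move=> /(_ (@norm_hausdorff _ _)) <-; rewrite lim_cst//; exact: norm_hausdorff.
Qed.

Lemma pvm_setU A B x : measurable A -> measurable B -> A `&` B = set0 ->
  E (A `|` B) x = E A x + E B x.
Proof.
move=> mA mB AB0.
have mbc k : measurable (bigcup2 A B k) by case: k => [|[|k]] /=.
have tbc : trivIset setT (bigcup2 A B) by rewrite -trivIset_bigcup2.
have [_ _ _ /(_ _ mbc tbc x)] := hE.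
rewrite bigcup2E -(cvg_shiftn 2) => /cvg_lim <-; last exact: norm_hausdorff.
apply: cvg_lim; first exact: norm_hausdorff.
rewrite (_ : (fun _ => _) = cst (E A x + E B x)); first exact: cvg_cst.
apply/funext => k; rewrite /series/= addn2.
rewrite (@big_ltn _ _ _ 0%N k.+2)// (@big_ltn _ _ _ 1%N k.+2)//.
rewrite big_nat_cond//= big1 ?addr0//.
by move=> [|[|i]]; rewrite ?andbF// pvm_set0.
Qed.

Lemma pvm_setCK B x : measurable B -> E B x + E (~` B) x = x.
Proof.
move=> mB; rewrite -pvm_setU ?setUv ?ET//; first exact: measurableC.
exact: setICr.
Qed.

Lemma pvm_idem B x : measurable B -> E B (E B x) = E B x.
Proof. by move=> mB; rewrite -EI// setIid. Qed.

Lemma pvm_normE B x : measurable B -> '[E B x, x] = '[E B x, E B x].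
Proof. by move=> mB; rewrite -[in RHS]symE// pvm_idem. Qed.

Lemma pvm_set_eq0 A B x : measurable A -> measurable B -> A `&` B = set0 ->
  E A (E B x) = 0.
Proof. by move=> mA mB AB0; rewrite -EI// AB0 pvm_set0. Qed.

Lemma pvm_disjoint A B x y : measurable A -> measurable B -> A `&` B = set0 ->
  '[E A x, E B y] = 0.
Proof. by move=> mA mB AB0; rewrite symE// pvm_set_eq0// inner0r. Qed.

Lemma scalar_spectral_measure_sigma_additive x :
  semi_sigma_additive (fun B : set R =>
    if `[< measurable B >] then ('[E B x, x])%:E else 0%E).
Proof.
move=> F mF tF mUF; have [_ _ _ /(_ F mF tF x) /cvg_innerl-/(_ x) h] := hE.
case: asboolP => // _.
rewrite [X in X @ _ --> _](_ : _ =
  EFin \o (fun n => '[series (fun k => E (F k) x) n, x])).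
  by apply: cvg_comp h _.
apply/funext => n /=.
rewrite /series/=.
elim: n => [|n ih]; first by rewrite !big_geq// inner0l.
rewrite !big_nat_recr//= innerDl EFinD ih; congr (_ + _)%E.
by case: asboolP => // /(_ (mF n)).
Qed.

(** The set function B |-> <E B x, x> need not be a measure as it stands: nothing
    is known about E on nonmeasurable sets, where it may even be negative.
    Extending it by 0 there gives a genuine measure with the same integrals, as
    these only involve the level sets of simple functions. *)
Lemma scalar_spectral_measureP x : exists mu : {measure set R -> \bar R},
  (forall B, measurable B -> mu B = ('[E B x, x])%:E) /\
  forall f : R -> \bar R,
    (\int[scalar_spectral_measure E x]_l f l = \int[mu]_l f l)%E.
Proof.
pose mu B : \bar R := if `[< measurable B >] then ('[E B x, x])%:E else 0%E.
have muE B : measurable B -> mu B = ('[E B x, x])%:E.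
  by rewrite /mu; case: asboolP.
have mu0 : mu set0 = 0%E by rewrite muE// pvm_set0 inner0l.
have mu_ge0 B : (0 <= mu B)%E.
  rewrite /mu; case: asboolP => // mB; rewrite lee_fin pvm_normE//.
  exact: inner_ge0.
have mu_add : semi_sigma_additive mu.
  exact: scalar_spectral_measure_sigma_additive.
pose mum := isMeasure.Build _ _ _ mu mu0 mu_ge0 mu_add.
pose m : {measure set R -> \bar R} := HB.pack mu mum.
exists m; split; first exact: muE.
move=> f; rewrite /integral.
have muEr (h : {nnsfun R >-> R}) :
  sintegral (scalar_spectral_measure E x) h = sintegral m h.
  rewrite /sintegral; apply: eq_fsbigr => r _; congr (_ * _)%E.
  by rewrite [RHS]muE.
by congr (ereal_sup _ - ereal_sup _)%E; apply: eq_imagel => h _.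
Qed.

(** The bound 1 is the one relevant to cosines; it makes every integral below
    finite and every such operator a contraction. *)
Definition spectral_form (f : R -> R) (T : {linear H -> H}) : Prop :=
  [/\ measurable_fun setT f, forall l, `|f l| <= 1,
      forall x y, '[T x, y] = '[x, T y] &
      forall x, ('[T x, x])%:E
                = (\int[scalar_spectral_measure E x]_l (f l)%:E)%E].

Lemma integrable_le1 (mu : {measure set R -> \bar R}) (f : R -> R) :
  (mu setT < +oo)%E -> measurable_fun setT f -> (forall l, `|f l| <= 1) ->
  mu.-integrable setT (EFin \o f).
Proof.
move=> mufin mf f1; apply: measurable_bounded_integrable => //.
by exists 1; split=> // r /ltW r1 l _; exact: le_trans (f1 l) r1.
Qed.

(** The scalar measures of the orthogonal vectors u = E B x and v = E (~` B) y
    add up to that of u + v, so the quadratic form of T is additive on them; by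
    symmetry of T, what it would otherwise gain is 2 <T u, v>. *)
Lemma spectral_form_cross f T B x y : measurable B -> spectral_form f T ->
  '[T (E B x), E (~` B) y] = 0.
Proof.
move=> mB [mf f1 symT formT]; have mC : measurable (~` B) by exact: measurableC.
pose u := E B x; pose v := E (~` B) y.
suff : '[T (u + v), u + v] = '[T u, u] + '[T v, v].
  rewrite linearD !(innerDl, innerDr) (symT v u) (innerC v); lra.
have cross A : measurable A -> '[E A u, v] = 0.
  by move=> mA; rewrite /u /v -EI// pvm_disjoint//; [exact: measurableI|
    rewrite -setIA setICr setI0].
have [mu [muE muI]] := scalar_spectral_measureP u.
have [mv [mvE mvI]] := scalar_spectral_measureP v.
have [mw [mwE mwI]] := scalar_spectral_measureP (u + v).
apply: EFin_inj; rewrite EFinD !formT muI mvI mwI.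
have fin (m : {measure set R -> \bar R}) z :
    (forall A, measurable A -> m A = ('[E A z, z])%:E) ->
    m.-integrable setT (EFin \o f).
  by move=> mE; apply: integrable_le1 => //; rewrite mE// ltry.
rewrite -integral_measure_add//; [|exact: fin muE|exact: fin mvE].
apply: eq_measure_integral => A mA _.
rewrite [RHS]measure_addE [RHS]/= muE// mvE// mwE// -EFinD linearD.
by rewrite !(innerDl, innerDr) (innerC (E A v) u) -symE// cross// addr0 add0r.
Qed.

(** By the previous lemma T maps the range of each E B into itself. *)
Lemma spectral_form_comm f T B x : measurable B -> spectral_form f T ->
  T (E B x) = E B (T x).
Proof.
move=> mB fT; have mC : measurable (~` B) by exact: measurableC.
have inv A z : measurable A -> E (~` A) (T (E A z)) = 0.
  move=> mA; have mA' := measurableC mA.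
  by apply: inner_eq0; rewrite -pvm_normE// symE// (spectral_form_cross _ _ mA fT).
rewrite -[in RHS](pvm_setCK x mB) !linearD.
rewrite -[X in _ = _ + E X _]setCK inv// addr0.
by rewrite -[LHS](pvm_setCK _ mB) inv// addr0.
Qed.

(** The scalar measure of a vector y in the range of E B is carried by B, where
    f lies between c - e and c + e. *)
Lemma spectral_form_near f T B c e y : measurable B -> spectral_form f T ->
  (forall l, B l -> `|f l - c| <= e) -> E B y = y ->
  `|'[T y, y] - c * '[y, y]| <= e * '[y, y].
Proof.
move=> mB [mf f1 _ formT] fB Ey.
have [mu [muE muI]] := scalar_spectral_measureP y.
have mC : measurable (~` B) by exact: measurableC.
have fint : mu.-integrable setT (EFin \o f).
  by apply: integrable_le1 => //; rewrite muE// ltry.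
have fB_int : mu.-integrable B (EFin \o f) by exact: integrableS fint.
have muB : mu B = ('[y, y])%:E by rewrite muE// Ey.
have cint r : mu.-integrable B (EFin \o cst r).
  apply: measurable_bounded_integrable => //; first by rewrite muB ltry.
  by exists `|r|; split=> // s /ltW rs l _ /=.
have cE r : (\int[mu]_(l in B) (EFin \o cst r) l = (r * '[y, y])%:E)%E.
  by rewrite -[LHS]/(\int[mu]_(l in B) (cst r%:E) l)%E integral_cst// muB.
have TyE : ('[T y, y])%:E = (\int[mu]_(l in B) (f l)%:E)%E.
  rewrite formT muI (negligible_integral mC)// ?setTD ?setCK//.
  by rewrite muE// -[in E _ y]Ey pvm_set_eq0 ?inner0l// setICl.
have lo : (((c - e) * '[y, y])%:E <= ('[T y, y])%:E)%E.
  rewrite TyE -cE; apply: le_integral => // l /set_mem/fB /=.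
  by rewrite lee_fin ler_norml => /andP[? ?]; lra.
have hi : (('[T y, y])%:E <= ((c + e) * '[y, y])%:E)%E.
  rewrite TyE -cE; apply: le_integral => // l /set_mem/fB /=.
  by rewrite lee_fin ler_norml => /andP[? ?]; lra.
move: lo hi; rewrite !lee_fin ler_norml => lo hi; apply/andP; split; lra.
Qed.

(** A symmetric operator is bounded in norm by any bound of its quadratic form.
    Here the operator is T - c restricted to the range of E B, which contains
    w = T y - c y; polarization is applied to y and w / e. *)
Lemma spectral_form_norm f T B c e y : measurable B -> spectral_form f T ->
  0 < e -> (forall l, B l -> `|f l - c| <= e) -> E B y = y ->
  `|T y - c *: y| <= e * `|y|.
Proof.
move=> mB fT e0 fB Ey; have [_ _ symT _] := fT.
(* The existential keeps w opaque: rewriting must not unfold it. *)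
have [w wE] : exists w, w = T y - c *: y by exists (T y - c *: y).
have Ew : E B w = w by rewrite wE linearB linearZ -(spectral_form_comm _ mB fT) Ey.
have bnd s : `|'[T (y + s *: w), y + s *: w]
   - c * '[y + s *: w, y + s *: w]| <= e * '[y + s *: w, y + s *: w].
  by apply: spectral_form_near fB _ => //; rewrite linearD linearZ Ew Ey.
have polar s : '[T (y + s *: w), y + s *: w] - c * '[y + s *: w, y + s *: w]
   = ('[T y, y] - c * '[y, y]) + 2 * s * '[w, w]
     + s ^+ 2 * ('[T w, w] - c * '[w, w]).
  have ww : '[w, w] = '[T y, w] - c * '[y, w].
    by rewrite [in LHS]wE innerDl innerNl innerZl -wE.
  rewrite linearD linearZ !(innerDl, innerDr, innerZl, innerZr).
  rewrite (symT w y) (innerC w (T y)) (innerC w y) ww; ring.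
have expand s : '[y + s *: w, y + s *: w]
   = '[y, y] + 2 * s * '[y, w] + s ^+ 2 * '[w, w].
  rewrite !(innerDl, innerDr, innerZl, innerZr) (innerC w y); ring.
(* The scaling by 1 / e balances the two squares, so that <w, w> is absorbed. *)
have := bnd e^-1; have := bnd (- e^-1).
rewrite !polar !expand !ler_norml sqrrN => /andP[h1 h2] /andP[h3 h4].
rewrite -(ler_pXn2r (n := 2))// ?nnegrE ?mulr_ge0 ?(ltW e0)//.
rewrite exprMn -!inner_norm -wE.
have h : 4 * e^-1 * '[w, w] <= 2 * e * ('[y, y] + e^-1 ^+ 2 * '[w, w]) by lra.
have := ler_wpM2l (ltW e0) h.
have -> : e * (4 * e^-1 * '[w, w]) = 4 * '[w, w] by field; exact: lt0r_neq0.
have -> : e * (2 * e * ('[y, y] + e^-1 ^+ 2 * '[w, w]))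
  = 2 * (e ^+ 2 * '[y, y]) + 2 * '[w, w] by field; exact: lt0r_neq0.
lra.
Qed.

Section SmallOnSlices.
Variable D : H -> H.
Hypothesis addD : forall x y, D (x + y) = D x + D y.
Hypothesis commD : forall B x, measurable B -> D (E B x) = E B (D x).

Definition small_on (e : R) B := forall x, `|D (E B x)| <= e * `|E B x|.

Lemma small_on_set0 e : 0 <= e -> small_on e set0.
Proof. by move=> e0 x; rewrite commD// !pvm_set0 !normr0 mulr0. Qed.

(** D commutes with E, so both x and D x split orthogonally along A and B, and
    the two bounds add up by Pythagoras' theorem. *)
Lemma small_on_setU e A B : 0 <= e -> measurable A -> measurable B ->
  A `&` B = set0 -> small_on e A -> small_on e B -> small_on e (A `|` B).
Proof.
move=> e0 mA mB AB0 sA sB x.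
have pyth u v :
    '[E A u + E B v, E A u + E B v] = '[E A u, E A u] + '[E B v, E B v].
  rewrite !(innerDl, innerDr) (innerC (E B v) (E A u)).
  by rewrite (pvm_disjoint u v mA mB AB0) addr0 add0r.
rewrite -(ler_pXn2r (n := 2))// ?nnegrE ?mulr_ge0//.
rewrite exprMn -!inner_norm pvm_setU// addD !commD// !pyth mulrDr lerD//.
  rewrite !inner_norm -exprMn ler_pXn2r ?nnegrE ?mulr_ge0//.
  by rewrite -commD//; exact: sA.
rewrite !inner_norm -exprMn ler_pXn2r ?nnegrE ?mulr_ge0//.
by rewrite -commD//; exact: sB.
Qed.

(** Slices of height d of the range of f can be glued one at a time, and finitely
    many of them cover [-1, 1]: a bound on D may be proved on sets where f
    oscillates by at most d. *)
Lemma small_on_slices (e d : R) (f : R -> R) B : 0 <= e -> 0 < d -> measurable B ->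
  measurable_fun setT f -> (forall l, `|f l| <= 1) ->
  (forall a, small_on e (B `&` f @^-1` `[a, a + d[)) -> small_on e B.
Proof.
move=> e0 d0 mB mf f1 sB.
have mS a b : measurable (B `&` f @^-1` `[a, b[).
  apply: measurableI => //; rewrite -[X in measurable X]setTI.
  exact: mf.
have step k : small_on e (B `&` f @^-1` `[-1, -1 + k%:R * d[).
  elim: k => [|k ih].
    rewrite mul0r addr0 set_itvco0 preimage_set0 setI0; exact: small_on_set0.
  have -> : B `&` f @^-1` `[-1, -1 + k.+1%:R * d[ =
     (B `&` f @^-1` `[-1, -1 + k%:R * d[) `|`
     (B `&` f @^-1` `[-1 + k%:R * d, -1 + k%:R * d + d[).
    rewrite -setIUr -preimage_setU; congr (_ `&` _ @^-1` _).
    have kd : 0 <= k%:R * d by rewrite mulr_ge0// ltW.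
    rewrite -natr1 mulrDl mul1r addrA; apply/seteqP; split=> l /=.
      rewrite !in_itv/= => /andP[h1 h2].
      by case: (ltP l (-1 + k%:R * d)) => h; [left|right]; rewrite ?h1 ?h ?h2.
    by rewrite !in_itv/= => -[] /andP[h1 h2]; apply/andP; split; lra.
  apply: small_on_setU => //; rewrite -subset0 => l /= -[[_ +] [_]].
  by rewrite !in_itv/= => /andP[_ h1] /andP[h2 _]; lra.
(* The slices must reach beyond 1, since the last one is half-open: 3 > 1 - (-1). *)
pose k := Num.bound (3 / d).
rewrite (_ : B = B `&` f @^-1` `[-1, -1 + k%:R * d[)//.
apply/seteqP; split=> [l Bl|l []//]; split=> //=; rewrite in_itv/=.
have : 3 / d < k%:R by apply: archi_boundP; rewrite divr_ge0// ltW.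
rewrite ltr_pdivrMr// => h; have := f1 l; rewrite ler_norml => /andP[? ?].
by apply/andP; split; lra.
Qed.

End SmallOnSlices.

(** The defect of the operator identity is small on every set where the four
    symbols oscillate little, since it vanishes when each operator is replaced by
    the value of its symbol at one point of the set; slicing the line by the four
    symbols in turn reduces the claim to such sets. *)
Lemma spectral_form_product fp fq fs ft P Q S T x :
  spectral_form fp P -> spectral_form fq Q -> spectral_form fs S ->
  spectral_form ft T -> (forall l, fp l + fq l = 2 * (fs l * ft l)) ->
  P x + Q x = 2 *: S (T x).
Proof.
move=> hP hQ hS hT fE.
pose D y := P y + Q y - 2 *: S (T y).
have addD y z : D (y + z) = D y + D z.
  by rewrite /D !linearD (addrACA (P y)); exact: addrACA.
have commD B y : measurable B -> D (E B y) = E B (D y).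
  move=> mB; rewrite /D [in RHS]linearB [X in _ = X - _]linearD [in RHS]linearZ_LR.
  rewrite (spectral_form_comm _ mB hP) (spectral_form_comm _ mB hQ).
  by rewrite (spectral_form_comm _ mB hT) (spectral_form_comm _ mB hS).
suff small d : 0 < d -> small_on D (6 * d) setT.
  apply/eqP; rewrite -subr_eq0 -normr_eq0 eq_le normr_ge0 andbT.
  apply/ler_addgt0Pl => e e0; rewrite addr0.
  have d0 : 0 < e / (6 * (`|x| + 1)).
    by rewrite divr_gt0// mulr_gt0// ltr_wpDl.
  have := small _ d0 x; rewrite ET => /le_trans; apply.
  have -> : 6 * (e / (6 * (`|x| + 1))) * `|x| = e * (`|x| / (`|x| + 1)).
    by field; rewrite lt0r_neq0// ltr_wpDl.
  by rewrite ler_piMr ?(ltW e0)// ler_pdivrMr ?ltr_wpDl// mul1r lerDl.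
move=> d0; have e0 : 0 <= 6 * d by rewrite mulr_ge0// ltW.
have [mp p1 _ _] := hP; have [mq q1 _ _] := hQ.
have [ms s1 _ _] := hS; have [mt t1 _ _] := hT.
have mI f B a : measurable_fun setT f -> measurable B ->
    measurable (B `&` f @^-1` `[a, a + d[).
  move=> mf mB; apply: measurableI => //; rewrite -[X in measurable X]setTI.
  exact: mf.
apply: (small_on_slices addD commD e0 d0 _ mp) => // a.
have mBp := mI _ _ a mp measurableT.
apply: (small_on_slices addD commD e0 d0 mBp mq) => // b.
have mBq := mI _ _ b mq mBp.
apply: (small_on_slices addD commD e0 d0 mBq ms) => // c.
have mBs := mI _ _ c ms mBq.
apply: (small_on_slices addD commD e0 d0 mBs mt) => // c'.
have mB := mI _ _ c' mt mBs.
set B := (X in small_on _ _ X) in mB *.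
have [->|/set0P[l0 Bl0]] := eqVneq B set0; first exact: small_on_set0.
move=> y; set z := E B y.
(* On B each symbol is within d of its value at the point l0, and these four
   values satisfy the identity exactly. *)
have Ez : E B z = z by exact: pvm_idem.
have osc g r l : (g @^-1` `[r, r + d[) l -> (g @^-1` `[r, r + d[) l0 ->
    `|g l - g l0| <= d.
  rewrite /= !in_itv/= => /andP[? ?] /andP[? ?]; rewrite ler_norml.
  by apply/andP; split; lra.
have near_p : `|P z - fp l0 *: z| <= d * `|z|.
  apply: (spectral_form_norm mB hP) => // l.
  by move: Bl0 => -[[[[_ h0] _] _] _] [[[[_ h] _] _] _]; exact: osc h h0.
have near_q : `|Q z - fq l0 *: z| <= d * `|z|.
  apply: (spectral_form_norm mB hQ) => // l.
  by move: Bl0 => -[[[[_ _] h0] _] _] [[[[_ _] h] _] _]; exact: osc h h0.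
have near_s : `|S z - fs l0 *: z| <= d * `|z|.
  apply: (spectral_form_norm mB hS) => // l.
  by move: Bl0 => -[[[[_ _] _] h0] _] [[[[_ _] _] h] _]; exact: osc h h0.
have near_t : `|T z - ft l0 *: z| <= d * `|z|.
  apply: (spectral_form_norm mB hT) => // l.
  by move: Bl0 => -[[[[_ _] _] _] h0] [[[[_ _] _] _] h]; exact: osc h h0.
have S_le w : `|S w| <= `|w|.
  have := @spectral_form_norm _ _ setT 0 1 w measurableT hS ltr01.
  rewrite scale0r subr0 mul1r; apply=> //.
  by move=> l _; rewrite subr0.
have -> : D z = (P z - fp l0 *: z) + (Q z - fq l0 *: z)
    - 2 *: (S (T z - ft l0 *: z) + ft l0 *: (S z - fs l0 *: z)).
  have -> : S (T z - ft l0 *: z) + ft l0 *: (S z - fs l0 *: z)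
      = S (T z) - (fs l0 * ft l0) *: z.
    by rewrite linearB linearZ_LR scalerBr scalerA (mulrC (ft l0)) addrA subrK.
  rewrite scalerBr scalerA -fE (scalerDl z) /D (addrACA (P z)) -opprD opprB.
  by rewrite [RHS]addrA subrK.
apply: le_trans (ler_normB _ _) _.
have : `|(P z - fp l0 *: z) + (Q z - fq l0 *: z)| <= d * `|z| + d * `|z|.
  exact: le_trans (ler_normD _ _) (lerD near_p near_q).
have : `|S (T z - ft l0 *: z) + ft l0 *: (S z - fs l0 *: z)|
    <= d * `|z| + d * `|z|.
  apply: le_trans (ler_normD _ _) (lerD (le_trans (S_le _) near_t) _).
  rewrite normrZ; apply: le_trans near_s.
  by rewrite ler_piMl.
rewrite normrZ ger0_norm//.
lra.
Qed.

Lemma measurable_cos_sqrt (t : R) :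
  measurable_fun setT (fun l : R => cos (t * Num.sqrt l)).
Proof.
apply: measurable_realfun.continuous_measurable_fun => l.
apply: continuous_comp; last exact: continuous_cos.
apply: continuousM; [exact: cst_continuous|exact: sqrt_continuous].
Qed.

End Spectral.

(** Product-to-sum formula.  The alternative on q reflects that cosine is even;
    it allows both orders of s and t without knowing that C is even. *)
Lemma cos_family_product (R : realType) (H : hilbertType R)
    (E : set R -> {linear H -> H}) (C : R -> {linear H -> H}) (p q s t : R) x :
  spectral_measure E ->
  (forall t : R,
     spectral_integral E (fun l => cos (t * Num.sqrt l)) (op_graph (C t))) ->
  p = s + t -> q = s - t \/ q = t - s ->
  C p x + C q x = 2 *: C s (C t x).
Proof.
move=> hE hC pE qE.
have form r : spectral_form E (fun l => cos (r * Num.sqrt l)) (C r).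
  have [_ sym int] := hC r; split.
  - exact: measurable_cos_sqrt.
  - by move=> l; exact: cos_max.
  - by move=> y z; exact: (sym (y, C r y) (z, C r z)).
  - by move=> y; exact: (int (y, C r y)).
apply: (spectral_form_product hE) (form p) (form q) (form s) (form t) _ => l.
have -> : cos (q * Num.sqrt l) = cos (s * Num.sqrt l - t * Num.sqrt l).
  by case: qE => ->; rewrite mulrBl// -cosN opprB.
rewrite pE mulrDl !cosD cosN sinN; ring.
Qed.

(** * Algebra of quasimatrices *)

Section QuasimatrixAlgebra.
Context {R : realType}.
Implicit Types H G : hilbertType R.

Lemma qmulA H p q r (W : 'rV[H]_p) (A : 'M[R]_(p, q)) (B : 'M[R]_(q, r)) :
  qmul (qmul W A) B = qmul W (A *m B).
Proof.
apply/rowP => j; rewrite !mxE; under eq_bigr do rewrite mxE scaler_sumr.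
rewrite exchange_big/=; apply: eq_bigr => i _; rewrite mxE scaler_suml.
by apply: eq_bigr => k _; rewrite scalerA mulrC.
Qed.

Lemma qmul1 H p (W : 'rV[H]_p) : qmul W 1%:M = W.
Proof.
apply/rowP => j; rewrite mxE (bigD1 j)//= big1 ?addr0 => [|i ij].
  by rewrite mxE eqxx scale1r.
by rewrite mxE (negPf ij) scale0r.
Qed.

Lemma map_qmul H G p q (F : {linear H -> G}) (W : 'rV[H]_p) (A : 'M[R]_(p, q)) :
  map_mx F (qmul W A) = qmul (map_mx F W) A.
Proof.
apply/rowP => j; rewrite !mxE linear_sum; apply: eq_bigr => i _.
by rewrite linearZ mxE.
Qed.

Lemma gram_tr H p q (W : 'rV[H]_p) (Z : 'rV[H]_q) : (gram W Z)^T = gram Z W.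
Proof. by apply/matrixP => i j; rewrite !mxE innerC. Qed.

Lemma gram_qmulr H p q r (W : 'rV[H]_p) (Z : 'rV[H]_q) (A : 'M[R]_(q, r)) :
  gram W (qmul Z A) = gram W Z *m A.
Proof.
apply/matrixP => i j; rewrite !mxE inner_sumr; apply: eq_bigr => k _.
by rewrite innerZr mxE mulrC.
Qed.

Lemma gram_qmull H p q r (W : 'rV[H]_p) (Z : 'rV[H]_q) (A : 'M[R]_(p, r)) :
  gram (qmul W A) Z = A^T *m gram W Z.
Proof. by rewrite -gram_tr gram_qmulr trmx_mul gram_tr. Qed.

Lemma gram_adjoint H G p q (F : G -> H) (FT : H -> G)
    (adj : forall x y, '[F x, y] = '[x, FT y]) (W : 'rV[H]_p) (Z : 'rV[G]_q) :
  gram (map_mx FT W) Z = gram W (map_mx F Z).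
Proof. by apply/matrixP => i j; rewrite !mxE innerC -adj innerC. Qed.

(** A vector v in the kernel of the Gram matrix gives a combination of the
    entries of W that is orthogonal to each of them, hence to itself. *)
Lemma gram_unit H p (W : 'rV[H]_p) : lin_indep W -> gram W W \in unitmx.
Proof.
move=> indW; rewrite -row_free_unit; apply: inj_row_free => v vG.
have z0 : \sum_i v 0 i *: W 0 i = 0.
  apply: inner_eq0; rewrite inner_sumr big1// => j _.
  rewrite innerZr inner_suml (_ : \sum__ _ = (v *m gram W W) 0 j).
    by rewrite vG mxE mulr0.
  by rewrite mxE; apply: eq_bigr => i _; rewrite innerZl mxE.
by apply/rowP => i; rewrite mxE; exact: indW z0 i.
Qed.

Lemma colspan_qmul_sub H p q (W : 'rV[H]_p) (A : 'M[R]_(p, q)) :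
  colspan (qmul W A) `<=` colspan W.
Proof.
move=> _ [c ->]; exists (fun i => \sum_j A i j * c j).
under eq_bigr do rewrite mxE scaler_sumr.
rewrite exchange_big/=; apply: eq_bigr => i _; rewrite scaler_suml.
by apply: eq_bigr => j _; rewrite scalerA mulrC.
Qed.

Lemma colspan_qmul H p (W : 'rV[H]_p) (A : 'M[R]_p) : A \in unitmx ->
  colspan (qmul W A) = colspan W.
Proof.
move=> uA; apply/seteqP; split; first exact: colspan_qmul_sub.
by rewrite -{1}[W]qmul1 -(mulmxV uA) -qmulA; exact: colspan_qmul_sub.
Qed.

(** Orthonormalization by any factor of the Gram matrix, triangular or not. *)
Lemma orthonormal_basis_qmul H p (W : 'rV[H]_p) (B : 'M[R]_p) : B \in unitmx ->
  gram W W = B^T *m B -> orthonormal_basis (qmul W (invmx B)) (colspan W).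
Proof.
move=> uB GB; split; last by rewrite colspan_qmul// unitmx_inv.
rewrite gram_qmull gram_qmulr GB mulmxK// trmx_inv.
by rewrite mulVmx ?unitmx_tr.
Qed.

End QuasimatrixAlgebra.

(** * Block structure *)

Section Blocks.
Context {R : realType} {n m : nat}.

Lemma sum_blocks (V : nmodType) (F : 'I_n -> 'I_m -> V) :
  \sum_(s < \sum_(i < n) m) F (tagnat.sig1 s) (tagnat.sig2 s)
  = \sum_i \sum_j F i j.
Proof.
rewrite sig_big_dep/= [RHS](reindex _ tagnat.sig_bij_on)/=.
by apply: eq_bigr.
Qed.

Lemma block_upper_triangular_mul (A B : 'M[R]_(\sum_(i < n) m)) :
  block_upper_triangular A -> block_upper_triangular B ->
  block_upper_triangular (A *m B).
Proof.
move=> uA uB i j ji.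
rewrite -[A]submxblockK -[B]submxblockK mul_mxblock mxblockK big1// => k _.
case: (ltnP k i) => [ki|ik]; first by rewrite uA// mul0mx.
by rewrite uB ?mulmx0//; exact: leq_trans ji ik.
Qed.

Lemma block_lower_triangular_tr (A : 'M[R]_(\sum_(i < n) m)) :
  block_lower_triangular A -> block_upper_triangular A^T.
Proof. by move=> lA i j ji; rewrite -tr_submxblock lA// trmx0. Qed.

Context {H : hilbertType R}.

Lemma quasimatrixE (w : nat -> 'rV[H]_m) s :
  quasimatrix n w 0 s = w (tagnat.sig1 s) 0 (tagnat.sig2 s).
Proof. by rewrite !mxE. Qed.

(** Independence in terms of double sums with coefficients indexed by natural
    numbers, so that blocks can be shifted without transporting ordinals. *)
Lemma lin_indep_quasimatrixP (w : nat -> 'rV[H]_m) :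
  lin_indep (quasimatrix n w) <->
  forall c : nat -> 'I_m -> R,
    \sum_(k < n) \sum_r c k r *: w k 0 r = 0 ->
    forall k r, (k < n)%N -> c k r = 0.
Proof.
split=> [ind c c0 k r kn|ind c c0 s].
  have := ind (fun s => c (tagnat.sig1 s) (tagnat.sig2 s)).
  under eq_bigr do rewrite quasimatrixE.
  rewrite (sum_blocks (fun i j => c i j *: w i 0 j)) => /(_ c0).
  move=> /(_ (tagnat.Rank (Ordinal kn) r)).
  have -> : tagnat.sig2 (tagnat.Rank (Ordinal kn) r) = r :> 'I_m.
    by rewrite tagnat.Rank2K; exact: val_inj.
  by rewrite tagnat.Rank1K.
pose d k r :=
  if insub k is Some i then c (@tagnat.Rank n (fun=> m) i r) else 0.
have dE (i : 'I_n) r : d i r = c (tagnat.Rank i r) by rewrite /d valK.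
rewrite -[s]tagnat.sig2K -dE; apply: ind => //; rewrite -[RHS]c0.
under [RHS]eq_bigr do rewrite quasimatrixE -[X in c X]tagnat.sig2K -dE.
by rewrite (sum_blocks (fun i j => d i j *: w i 0 j)).
Qed.

Lemma qmul_block_unit (w : nat -> 'rV[H]_m) j : (j < n)%N ->
  qmul (quasimatrix n w) (block_unit n m j) = w j.
Proof.
move=> jn; apply/rowP => r; rewrite mxE.
under eq_bigr do rewrite quasimatrixE !mxE.
rewrite (sum_blocks (fun i k => ((i == j :> nat)%:R *+ (k == r)) *: w i 0 k)).
rewrite (bigD1 (Ordinal jn))//= [X in _ + X]big1 ?addr0 => [|i ij].
  rewrite eqxx (bigD1 r)//= big1 ?addr0 => [|k kr].
    by rewrite eqxx scale1r.
  by rewrite (negPf kr) scale0r.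
have /negPf -> : (i != j :> nat) by [].
by rewrite big1// => k _; rewrite mul0rn scale0r.
Qed.

Lemma qmul_mxrow p (W : 'rV[H]_p) (A : nat -> 'M[R]_(p, m)) :
  qmul W (\mxrow_(j < n) A j) = quasimatrix n (fun j => qmul W (A j)).
Proof.
by apply/rowP => s; rewrite !mxE; apply: eq_bigr => i _; rewrite mxE.
Qed.

End Blocks.

(** * Primal and dual snapshots of the reduced order model *)

Section ReducedOrderModel.
Context {R : realType} {H Hh : hilbertType R} {m n : nat}.
Variables (tau : R) (P : {linear H -> H}) (u : nat -> 'rV[H]_m).
Hypothesis u1 : forall r, P (u 0%N 0 r) = u 1%N 0 r.
Hypothesis u_rec : forall j r, 2 *: P (u j.+1 0 r) = u j.+2 0 r + u j 0 r.

Let U := quasimatrix n u.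
Let e := @block_unit R n m.

Section Snapshots.
Variable Rb : 'M[R]_(\sum_(i < n) m).
Hypothesis uRb : Rb \in unitmx.
Hypothesis massE : gram U U = Rb^T *m Rb.

Let PROM := (invmx Rb)^T *m gram U (map_mx P U) *m invmx Rb.

(** The reduced propagator acts on the coordinates of a snapshot by propagating
    it in H and projecting the result back. *)
Lemma PROM_block j (Z : 'rV[H]_m) : (j < n)%N -> Z = map_mx P (u j) ->
  PROM *m (Rb *m e j) = (invmx Rb)^T *m gram U Z.
Proof.
move=> jn ->; rewrite /PROM -!mulmxA mulKmx//.
by rewrite -gram_qmulr -map_qmul qmul_block_unit.
Qed.

(** A snapshot in the projection space is reproduced by the projection. *)
Lemma galerkin_snapshot j : (j < n)%N ->
  (invmx Rb)^T *m gram U (u j) = Rb *m e j.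
Proof.
move=> jn; rewrite -(qmul_block_unit u jn) gram_qmulr massE -mulmxA.
by rewrite trmx_inv mulKmx ?unitmx_tr.
Qed.

(** The propagated snapshots of index up to n - 1 stay in the projection space, so
    that projecting loses nothing and both recursions agree. *)
Lemma rom_snapshotE j : (j < n)%N ->
  rom_snapshot PROM (Rb *m e 0) (Rb *m e 1) j = Rb *m e j.
Proof.
pose s := rom_snapshot PROM (Rb *m e 0) (Rb *m e 1).
suff h : forall k, (k < n)%N ->
    s k = Rb *m e k /\ ((k.+1 < n)%N -> s k.+1 = Rb *m e k.+1).
  by move=> /h[].
elim=> [//|k ih] kn; have [ih0 /(_ kn) ih1] := ih (ltnW kn).
split=> // k2n.
change (2 *: (PROM *m s k.+1) - s k = Rb *m e k.+2).
rewrite ih0 ih1 (PROM_block kn erefl) scalemxAr.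
rewrite -[in RHS](galerkin_snapshot k2n) -(galerkin_snapshot (ltnW (ltnW k2n))).
rewrite -mulmxBr; congr (_ *m _); apply/matrixP => i r; rewrite !mxE.
by rewrite -innerZr u_rec innerDr addrK.
Qed.

End Snapshots.

Variables (L : {linear Hh -> H}) (LT : {linear H -> Hh}).
Hypothesis tau_gt0 : 0 < tau.
Hypothesis L_adj : forall x y, '[L x, y] = '[x, LT y].
Hypothesis L_fact : forall x, (2 / tau ^+ 2) *: (x - P x) = L (LT x).

Let uh := dual_snapshot tau LT u.

(** The other half of the leap-frog scheme, from L LT = 2 / tau^2 (I - P) and the
    three-term recursion. *)
Lemma dual_snapshot_leapfrog j r :
  L (uh j 0 r) = tau^-1 *: (u j 0 r - u j.+1 0 r).
Proof.
have t0 : tau != 0 by rewrite lt0r_neq0.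
elim: j => [|j ih].
  rewrite /uh /= mxE linearZ_LR -L_fact scalerA u1; congr (_ *: _); by field.
rewrite /uh /= -/uh !mxE linearD ih linearZ_LR -L_fact scalerA.
have -> : tau * (2 / tau ^+ 2) = tau^-1 * 2 by field.
rewrite -scalerA -scalerDr; congr (_ *: _).
rewrite scalerBr u_rec scaler_nat mulr2n opprD (addrC (- _)) !addrA subrK.
by rewrite (addrAC (u j 0 r)) subrr add0r.
Qed.

(** L maps the dual snapshots to multiples of the increments u_j - u_{j+1}, and
    these are independent because the n + 1 snapshots are. *)
Lemma dual_snapshots_lin_indep :
  lin_indep (quasimatrix n.+1 u) -> lin_indep (quasimatrix n uh).
Proof.
move=> /lin_indep_quasimatrixP ind; apply/lin_indep_quasimatrixP => c c0.
(* Summation by parts: the coefficient of u_k in the combination of the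
   increments u_k - u_{k+1} is c_k - c_{k-1}, with c_{-1} = c_n = 0. *)
pose head k r := if (k < n)%N then c k r else 0.
pose tail k r := if k is k'.+1 then c k' r else 0.
pose d k r := head k r - tail k r.
have dE : forall k r, (k < n.+1)%N -> d k r = 0.
  apply: ind.
  have -> : \sum_(k < n.+1) \sum_r d k r *: u k 0 r =
      \sum_(k < n) \sum_r c k r *: (u k 0 r - u k.+1 0 r).
    transitivity (\sum_(k < n.+1) \sum_r head k r *: u k 0 r
      - \sum_(k < n.+1) \sum_r tail k r *: u k 0 r).
      rewrite -sumrB; apply: eq_bigr => k _; rewrite -sumrB; apply: eq_bigr => r _.
      by rewrite -scalerBl.
    rewrite big_ord_recr/= {2}/head ltnn [X in _ + X - _]big1 ?addr0 => [|r _]; last first.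
      by rewrite scale0r.
    rewrite big_ord_recl/= [X in _ - (X + _)]big1 ?add0r => [|r _]; last first.
      by rewrite scale0r.
    rewrite -sumrB; apply: eq_bigr => k _; rewrite -sumrB; apply: eq_bigr => r _.
    by rewrite /head ltn_ord scalerBr.
  have := congr1 (fun x => tau *: L x) c0; rewrite !linear0; apply: etrans.
  rewrite (linear_sum L) scaler_sumr; apply: eq_bigr => k _.
  rewrite (linear_sum L) scaler_sumr; apply: eq_bigr => r _.
  rewrite linearZ_LR dual_snapshot_leapfrog !scalerA; congr (_ *: _).
  by field; exact: lt0r_neq0.
elim=> [|k ih] r kn.
  by have := dE 0%N r isT; rewrite /d /head kn subr0.
have := dE k.+1 r (leqW kn); rewrite /d /head kn /= ih ?subr0//; exact: ltnW.
Qed.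

Lemma snapshots_lin_indep : lin_indep (quasimatrix n.+1 u) -> lin_indep U.
Proof.
move=> /lin_indep_quasimatrixP ind; apply/lin_indep_quasimatrixP => c c0 k r kn.
have := ind (fun k r => if (k < n)%N then c k r else 0).
rewrite big_ord_recr/= ltnn [X in _ + X]big1 ?addr0 => [|s _]; last first.
  by rewrite scale0r.
under eq_bigr do under eq_bigr do rewrite ltn_ord.
by move=> /(_ c0 k r (leqW kn)); rewrite kn.
Qed.

(** The coefficients of the leap-frog sums: running the scheme on the block unit
    vectors with the identity as operator gives
    h_j = tau (e_0 / 2 + e_1 + ... + e_j). *)
Let h := rom_dual_snapshot tau 1%:M e.

Lemma dual_snapshotE j : (j < n)%N -> uh j = map_mx LT (qmul U (h j)).
Proof.
have qmulD (A A' : 'M[R]_(\sum_(i < n) m, m)) :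
    qmul U (A + A') = qmul U A + qmul U A'.
  apply/rowP => i; rewrite !mxE -big_split; apply: eq_bigr => k _.
  by rewrite mxE scalerDl.
have qmulZ (a : R) k : (k < n)%N ->
    map_mx LT (qmul U (a *: (1%:M^T *m e k))) = map_mx (fun x => a *: LT x) (u k).
  move=> kn; rewrite trmx1 mul1mx -(qmul_block_unit u kn) -/U -/(e k).
  apply/rowP => i; rewrite !mxE -linearZ_LR scaler_sumr; congr (LT _).
  by apply: eq_bigr => s _; rewrite mxE scalerA.
elim: j => [|j ih] jn; first by rewrite /h /= qmulZ.
by rewrite /uh /h /= qmulD map_mxD qmulZ// -ih// ltnW.
Qed.

Lemma rom_dual_snapshotE (A Lr : 'M[R]_(\sum_(i < n) m)) v j :
  (forall k, (k <= j)%N -> v k = A *m e k) ->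
  rom_dual_snapshot tau Lr v j = Lr^T *m A *m h j.
Proof.
elim: j => [|j ih] vE.
  by rewrite /h /= vE// trmx1 mul1mx -scalemxAr mulmxA.
rewrite /h /= -/h ih => [|k kj]; last by apply: vE; exact: leqW.
by rewrite vE// trmx1 mul1mx mulmxDr -scalemxAr mulmxA.
Qed.

Lemma leapfrog_coeff_upper : block_upper_triangular (\mxrow_(j < n) h j).
Proof.
move=> i j ji; rewrite submxblockEh mxrowK.
have e0 a k : (k < i)%N -> submxcol (a *: e k) i = 0 :> 'M[R]_m.
  move=> ki; have : submxcol (e k) i = 0 :> 'M[R]_m.
    by rewrite mxcolK gtn_eqF// raddf0.
  move=> /matrixP ek; apply/matrixP => r s.
  by have := ek r s; rewrite !mxE => ->; rewrite mulr0.
elim: (nat_of_ord j) ji => [|k ih] ki; rewrite /h /= trmx1 mul1mx.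
  exact: e0.
by rewrite -/h submxcolD ih ?e0 ?addr0// ltnW.
Qed.

End ReducedOrderModel.

(** * Orthonormal dual basis and Petrov-Galerkin projection *)

Theorem theorem2p5 (R : realType) (K H Hh : hilbertType R)
    (m n : nat) (hm : (1 <= m)%N) (hn : (2 <= n)%N)
    (tau : R) (htau : 0 < tau)
    (Lq : set (K * H)) (hLq : densely_defined_operator Lq)
    (hA : selfadjoint_nonneg (op_comp Lq (op_adjoint Lq)))
    (E : set R -> {linear H -> H}) (hE : spectral_measure E)
    (hAE : spectral_integral E (fun l => l) (op_comp Lq (op_adjoint Lq)))
    (C : R -> {linear H -> H})
    (hC : forall t : R,
       spectral_integral E (fun l => cos (t * Num.sqrt l)) (op_graph (C t)))
    (L : {linear Hh -> H}) (LT : {linear H -> Hh})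
    (hLc : continuous L) (hLTc : continuous LT)
    (hLadj : forall x y, '[L x, y] = '[x, LT y])
    (hLfact : forall x, (2 / tau ^+ 2) *: (x - C tau x) = L (LT x))
    (b : 'rV[H]_m)
    (hindep : lin_indep (quasimatrix n.+1 (snapshot C tau b)))
    (Rb LROM : 'M[R]_(\sum_(i < n) m)) :
  let P := C tau in
  let u := snapshot C tau b in
  let U := quasimatrix n u in
  let M := gram U U in
  let S := gram U (map_mx P U) in
  M = Rb^T *m Rb -> block_upper_triangular Rb ->
  let V := qmul U (invmx Rb) in
  let PROM := (invmx Rb)^T *m S *m invmx Rb in
  (2 / tau ^+ 2) *: (1%:M - PROM) = LROM *m LROM^T ->
  block_lower_triangular LROM ->
  let uROM := rom_snapshot PROM (Rb *m block_unit n m 0) (Rb *m block_unit n m 1) in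
  let uhROM := rom_dual_snapshot tau LROM uROM in
  let Uh := quasimatrix n (dual_snapshot tau LT u) in
  let Xh := colspan Uh in
  let Rh := \mxrow_(j < n) uhROM j in
  [/\ exists Vh : 'rV[Hh]_(\sum_(i < n) m),
        orthonormal_basis Vh Xh /\ Uh = qmul Vh Rh,
      block_upper_triangular Rh &
      forall Vh : 'rV[Hh]_(\sum_(i < n) m),
        orthonormal_basis Vh Xh -> Uh = qmul Vh Rh ->
        LROM = gram V (map_mx L Vh)].
Proof.
move=> P u U M S massE upRb V PROM stiffE lowL uROM uhROM Uh Xh Rh.
(* The product formula with s = tau and t = 0, where p = q = tau. *)
have u_1 r : P (u 0%N 0 r) = u 1%N 0 r.
  have := cos_family_product (b 0 r) hE hC
    (esym (addr0 tau)) (or_introl (esym (subr0 tau))).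
  rewrite -mulr2n -scaler_nat !mxE mul0r mul1r => /(scalerI _) -> //.
have u_rec j r : 2 *: P (u j.+1 0 r) = u j.+2 0 r + u j 0 r.
  rewrite !mxE -(cos_family_product (p := j.+2%:R * tau) (q := j%:R * tau) _ hE hC)//.
    by rewrite -[j.+2%:R]natr1; ring.
  by right; rewrite -natr1; ring.
have uUU : gram U U \in unitmx.
  by apply: gram_unit; exact: snapshots_lin_indep hindep.
have uRb : Rb \in unitmx.
  by move: uUU; rewrite -/M massE unitmx_mul => /andP[].
pose Hm : 'M[R]_(\sum_(i < n) m) :=
  \mxrow_(j < n) rom_dual_snapshot tau 1%:M (block_unit n m) j.
have RhE : Rh = LROM^T *m Rb *m Hm.
  rewrite /Rh /Hm mul_mxrow; apply: eq_mxrow => j.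
  apply: rom_dual_snapshotE => k kj.
  by apply: rom_snapshotE => //; exact: leq_ltn_trans kj (ltn_ord j).
have UhE : Uh = map_mx LT (qmul U Hm).
  rewrite map_qmul qmul_mxrow /Uh.
  apply/rowP => s; rewrite !quasimatrixE -map_qmul.
  by rewrite (dual_snapshotE _ _ _ (ltn_ord _)).
(* L LT and LROM LROM^T are the same affine functions of P and of PROM. *)
have LLE : gram U (map_mx L (map_mx LT U)) = Rb^T *m (LROM *m LROM^T) *m Rb.
  rewrite -stiffE -scalemxAr -scalemxAl mulmxBr mulmxBl mulmx1 -massE.
  have -> : Rb^T *m PROM *m Rb = S.
    by rewrite /PROM trmx_inv mulmxA -!mulmxA mulVmx// mulmx1 mulKVmx// unitmx_tr//.
  by apply/matrixP => i j; rewrite !mxE -hLfact innerZr innerDr innerNr.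
have uUhUh : gram Uh Uh \in unitmx.
  apply: gram_unit.
  exact: (dual_snapshots_lin_indep u_1 u_rec htau hLfact) hindep.
have gramUh : gram Uh Uh = Rh^T *m Rh.
  rewrite {1}UhE (gram_adjoint hLadj) UhE !map_qmul gram_qmull gram_qmulr LLE RhE.
  by rewrite !trmx_mul trmxK !mulmxA.
have uRh : Rh \in unitmx.
  by move: uUhUh; rewrite gramUh unitmx_mul => /andP[].
split.
- exists (qmul Uh (invmx Rh)); split; first exact: orthonormal_basis_qmul.
  by rewrite qmulA mulVmx// qmul1.
- rewrite RhE; apply: block_upper_triangular_mul; last exact: leapfrog_coeff_upper.
  apply: block_upper_triangular_mul => //; exact: block_lower_triangular_tr.
- move=> Vh _ UhV.
  have -> : Vh = qmul Uh (invmx Rh) by rewrite UhV qmulA mulmxV// qmul1.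
  rewrite /V map_qmul gram_qmull gram_qmulr UhE !map_qmul gram_qmulr LLE.
  rewrite trmx_inv !mulmxA mulVmx ?unitmx_tr// mul1mx -!mulmxA.
  (* What is left is LROM times (LROM^T Rb Hm) Rh^-1 = Rh Rh^-1. *)
  by rewrite (mulmxA Rb) (mulmxA LROM^T) (mulmxA LROM^T) -RhE mulmxV// mulmx1.
Qed.
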